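(* The hypersequent calculus for $\mathsf{S5}$ has the bisimulation hypersequent uniform interpolation property (BHUIP): for every hypersequent $\mathcal{G}=\Gamma_1\mid\dots\mid\Gamma_n$ all of whose formulas have modal depth at most $1$ and every atomic proposition $p$, there is a multiformula $A_p(\mathcal{G})$ such that (i) $\mathit{Var}(A_p(\mathcal{G}))\subseteq\mathit{Var}(\mathcal{G})\setminus\{p\}$ and the labels of $A_p(\mathcal{G})$ are among $1,\dots,n$; (ii) for every multiworld interpretation $w_1,\dots,w_n$ of $\mathcal{G}$ into an $\mathsf{S5}$-model $\mathcal{M}$, $\mathcal{M},w_1,\dots,w_n\models A_p(\mathcal{G})$ implies $\mathcal{M},w_1,\dots,w_n\models\mathcal{G}$; (iii)$'$ if $\mathcal{M},w_1,\dots,w_n\not\models A_p(\mathcal{G})$, then there are an $\mathsf{S5}$-model $\mathcal{M}'$ and worlds $w'_1,\dots,w'_n$ of $\mathcal{M}'$ with $(\mathcal{M},w_1,\dots,w_n)\sim_p(\mathcal{M}',w'_1,\dots,w'_n)$ and $\mathcal{M}',w'_1,\dots,w'_n\not\models\mathcal{G}$.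
   Context: Formulas are modal formulas in negation normal form (built from $\bot,\top,p,\overline p$ with $\land,\lor,\Box,\Diamond$). A hypersequent $\mathcal{G}=\Gamma_1\mid\dots\mid\Gamma_n$ is a collection of multisets of formulas with formula interpretation $\Box(\bigvee\Gamma_1)\lor\dots\lor\Box(\bigvee\Gamma_n)$; its components are labelled $1,\dots,n$ and $k:\varphi\in\mathcal{G}$ means $\varphi\in\Gamma_k$. The calculus is the terminating (Kleene'd) hypersequent calculus for $\mathsf{S5}$ with rules $\mathsf{id_P}$, $\mathsf{id_\top}$, $\lor$, $\land$, $\Box$ (from $\mathcal{G}\mid\Gamma,\Box\varphi\mid\varphi$ infer $\mathcal{G}\mid\Gamma,\Box\varphi$), $\mathsf{k}$ (from $\mathcal{G}\mid\Gamma,\Diamond\varphi\mid\Delta,\varphi$ infer $\mathcal{G}\mid\Gamma,\Diamond\varphi\mid\Delta$) and $\mathsf{t}$ (from $\mathcal{G}\mid\Gamma,\Diamond\varphi,\varphi$ infer $\mathcal{G}\mid\Gamma,\Diamond\varphi$). $\mathsf{S5}$-models are finite single clusters $(W,W\times W,V)$. A (cluster-like) multiworld interpretation of $\mathcal{G}$ into such a model is any map $k\mapsto w_k\in W$, $k=1,\dots,n$; $\mathcal{M},w_1,\dots,w_n\models\mathcal{G}$ iff $\mathcal{M},w_i\models\varphi$ for some $i$ and some $\varphi\in\Gamma_i$. Multiformulas are $\mho::=k:\varphi\mid(\mho\curlywedge\mho)\mid(\mho\curlyvee\mho)$ with $k$ a natural-number label, $\curlywedge$ multiformula conjunction and $\curlyvee$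 multiformula disjunction (interpreted classically), and $\mathcal{M},w_1,\dots,w_n\models k:\varphi$ iff $\mathcal{M},w_k\models\varphi$. $(\mathcal{M},w_1,\dots,w_n)\sim_p(\mathcal{M}',w'_1,\dots,w'_n)$ means there is a bisimulation up to $p$ (related worlds agree on all atoms other than $p$; forth and back conditions) relating each $w_k$ to $w'_k$. The restriction to modal depth $\le1$ is harmless since every modal formula is $\mathsf{S5}$-equivalent to one of modal depth at most $1$. *)

(* Defs.v *)
From HB Require Import structures.
From mathcomp Require Import all_boot finmap multiset.

Set Implicit Arguments.
Unset Strict Implicit.
Unset Printing Implicit Defensive.

Local Open Scope mset_scope.

Inductive form (atom : Type) : Type :=
| Bot
| Top
| Var of atom
| NVar of atom
| And of form atom & form atom
| Or of form atom & form atom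
| Box of form atom
| Dia of form atom.

Arguments Bot {atom}.
Arguments Top {atom}.

(* The choiceType structure on formulas is what {mset form atom} requires. *)
Section FormChoice.
Variable atom : Type.

Fixpoint tree_of_form (f : form atom) : GenTree.tree atom :=
  match f with
  | Bot => GenTree.Node 0 [::]
  | Top => GenTree.Node 1 [::]
  | Var q => GenTree.Node 2 [:: GenTree.Leaf q]
  | NVar q => GenTree.Node 3 [:: GenTree.Leaf q]
  | And f g => GenTree.Node 4 [:: tree_of_form f; tree_of_form g]
  | Or f g => GenTree.Node 5 [:: tree_of_form f; tree_of_form g]
  | Box f => GenTree.Node 6 [:: tree_of_form f]
  | Dia f => GenTree.Node 7 [:: tree_of_form f]
  end.

Fixpoint form_of_tree (t : GenTree.tree atom) : form atom :=
  match t with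
  | GenTree.Node 1 [::] => Top
  | GenTree.Node 2 [:: GenTree.Leaf q] => Var q
  | GenTree.Node 3 [:: GenTree.Leaf q] => NVar q
  | GenTree.Node 4 [:: t; u] => And (form_of_tree t) (form_of_tree u)
  | GenTree.Node 5 [:: t; u] => Or (form_of_tree t) (form_of_tree u)
  | GenTree.Node 6 [:: t] => Box (form_of_tree t)
  | GenTree.Node 7 [:: t] => Dia (form_of_tree t)
  | _ => Bot
  end.

Lemma tree_of_formK : cancel tree_of_form form_of_tree.
Proof. by elim=> //= [f -> g -> | f -> g -> | f -> | f ->]. Qed.

End FormChoice.

HB.instance Definition _ (atom : eqType) :=
  Equality.copy (form atom) (can_type (@tree_of_formK atom)).
HB.instance Definition _ (atom : choiceType) :=
  Choice.copy (form atom) (can_type (@tree_of_formK atom)).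

Fixpoint depth (atom : Type) (f : form atom) : nat :=
  match f with
  | Bot | Top | Var _ | NVar _ => 0
  | And f g | Or f g => maxn (depth f) (depth g)
  | Box f | Dia f => (depth f).+1
  end.

Fixpoint vars (atom : Type) (f : form atom) : seq atom :=
  match f with
  | Bot | Top => [::]
  | Var q | NVar q => [:: q]
  | And f g | Or f g => vars f ++ vars g
  | Box f | Dia f => vars f
  end.

Record model (atom : Type) : Type := Model {
  world : finType;
  acc : rel world;
  val : atom -> {set world}
}.

(* A single cluster: acc is all of W x W. *)
Definition S5_model (atom : Type) (M : model atom) : Prop :=
  forall x y : world M, acc x y.

Fixpoint sat (atom : Type) (M : model atom) (w : world M) (f : form atom)
    : bool :=
  match f with
  | Bot => false
  | Top => true
  | Var q => w \in val M q
  | NVar q => w \notin val M q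
  | And f g => sat w f && sat w g
  | Or f g => sat w f || sat w g
  | Box f => [forall v, acc w v ==> sat v f]
  | Dia f => [exists v, acc w v && sat v f]
  end.

(* The component labelled k in 1, ..., n is tnth G i with k = i.+1. *)
Definition hypersequent (atom : choiceType) (n : nat) : Type :=
  n.-tuple {mset form atom}.

Definition in_hypersequent (atom : choiceType) (n : nat)
    (G : hypersequent atom n) (k : nat) (f : form atom) : Prop :=
  exists2 i : 'I_n, k = i.+1 & f \in tnth G i.

Definition hvar (atom : choiceType) (n : nat) (G : hypersequent atom n)
    (q : atom) : Prop :=
  exists k f, in_hypersequent G k f /\ q \in vars f.

Definition interpretation (atom : Type) (n : nat) (M : model atom) : Type :=
  'I_n -> world M.

Definition hsat (atom : choiceType) (n : nat) (M : model atom)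
    (w : interpretation n M) (G : hypersequent atom n) : Prop :=
  exists i f, f \in tnth G i /\ sat (w i) f.

Inductive multiformula (atom : Type) : Type :=
| MLabel of nat & form atom
| MAnd of multiformula atom & multiformula atom
| MOr of multiformula atom & multiformula atom.

Fixpoint mvars (atom : Type) (A : multiformula atom) : seq atom :=
  match A with
  | MLabel _ f => vars f
  | MAnd A B | MOr A B => mvars A ++ mvars B
  end.

Fixpoint mlabels (atom : Type) (A : multiformula atom) : seq nat :=
  match A with
  | MLabel k _ => [:: k]
  | MAnd A B | MOr A B => mlabels A ++ mlabels B
  end.

(* A label outside 1, ..., n denotes no world and makes k : f false. *)
Fixpoint msat (atom : Type) (n : nat) (M : model atom)
    (w : interpretation n M) (A : multiformula atom) : Prop :=
  match A with
  | MLabel k f => exists2 i : 'I_n, k = i.+1 & sat (w i) f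
  | MAnd A B => msat w A /\ msat w B
  | MOr A B => msat w A \/ msat w B
  end.

Record bisimulation_upto (atom : Type) (p : atom) (M M' : model atom)
    (Z : world M -> world M' -> Prop) : Prop := BisimulationUpto {
  bisim_atom : forall x x' q, Z x x' -> q <> p ->
    (x \in val M q) = (x' \in val M' q);
  bisim_forth : forall x x' y, Z x x' -> acc x y ->
    exists2 y', acc x' y' & Z y y';
  bisim_back : forall x x' y', Z x x' -> acc x' y' ->
    exists2 y, acc x y & Z y y'
}.

Definition bisimilar_upto (atom : Type) (p : atom) (n : nat)
    (M : model atom) (w : interpretation n M)
    (M' : model atom) (w' : interpretation n M') : Prop :=
  exists Z : world M -> world M' -> Prop,
    bisimulation_upto p Z /\ forall i, Z (w i) (w' i).

(* Main.v *)
Require Import Defs.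
From mathcomp Require Import all_boot finmap multiset.

(** Let [S] be the finite set of atoms of [G]. Up to the truth of formulas over
    [S], a cluster with [n] marked worlds is given by the set [D] of [S]-types
    it realises and the [S]-types of the marked worlds; there are finitely many
    such configurations. [A] says that the model does not match, on the atoms
    other than [p], any configuration refuting [G]. If [M] does match a
    refuting configuration, then the pairs of a world of [M] and a type in [D]
    that agree off [p], with [p] read from the type and all other atoms from the
    world, form a cluster that is bisimilar to [M] up to [p] and refutes [G]. *)

Set Implicit Arguments.
Unset Strict Implicit.
Unset Printing Implicit Defensive.

(** * Finite conjunctions and disjunctions, and truth along surjections of clusters *)

Section Formulas.
Variable atom : choiceType.
Implicit Types (f g : form atom) (M N : model atom) (P : pred atom).

Definition big_and (fs : seq (form atom)) := foldr (@And atom) Top fs.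
Definition big_or (fs : seq (form atom)) := foldr (@Or atom) Bot fs.

Lemma sat_big_and M (x : world M) fs : sat x (big_and fs) = all (sat x) fs.
Proof. by elim: fs => //= f fs ->. Qed.

Lemma sat_big_or M (x : world M) fs : sat x (big_or fs) = has (sat x) fs.
Proof. by elim: fs => //= f fs ->. Qed.

Lemma vars_big_and P fs :
  all P (vars (big_and fs)) = all (fun f => all P (vars f)) fs.
Proof. by elim: fs => //= f fs <-; rewrite all_cat. Qed.

Lemma vars_big_or P fs :
  all P (vars (big_or fs)) = all (fun f => all P (vars f)) fs.
Proof. by elim: fs => //= f fs <-; rewrite all_cat. Qed.

Lemma sat_Or M (x : world M) f g : sat x (Or f g) = sat x f || sat x g.
Proof. by []. Qed.

Lemma sat_Box M (x : world M) f :
  S5_model M -> sat x (Box f) = [forall y : world M, sat y f].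
Proof. by move=> S5 /=; apply: eq_forallb => y; rewrite S5. Qed.

Lemma sat_Dia M (x : world M) f :
  S5_model M -> sat x (Dia f) = [exists y : world M, sat y f].
Proof. by move=> S5 /=; apply: eq_existsb => y; rewrite S5. Qed.

(** In a cluster a modality ranges over all worlds, so surjectivity of [h] alone handles [Box] and
    [Dia]; only the literals use the agreement on [S]. *)
Lemma sat_surjection (S : seq atom) M N (h : world M -> world N) f :
  S5_model M -> S5_model N -> (forall y, exists x, h x = y) ->
  (forall x q, q \in S -> (x \in Defs.val M q) = (h x \in Defs.val N q)) ->
  {subset vars f <= S} -> forall x, sat x f = sat (h x) f.
Proof.
move=> S5M S5N h_surj h_val.
elim: f => [||q|q|f IHf g IHg|f IHf g IHg|f IHf|f IHf] sub x //.
- by apply: h_val; apply: sub; rewrite mem_head.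
- by rewrite /= (h_val x q) //; apply: sub; rewrite mem_head.
- by rewrite /= IHf ?IHg // => q q_in; apply: sub; rewrite mem_cat q_in ?orbT.
- by rewrite /= IHf ?IHg // => q q_in; apply: sub; rewrite mem_cat q_in ?orbT.
- rewrite !sat_Box //; apply/forallP/forallP => [H y|H y].
    by have [z <-] := h_surj y; rewrite -IHf.
  by rewrite IHf.
- rewrite !sat_Dia //; apply/existsP/existsP => [[y H]|[y H]].
    by exists (h y); rewrite -IHf.
  by have [z hz] := h_surj y; exists z; rewrite IHf // hz.
Qed.

(** Multiformulas have no constants, so the unit is [Top] at label 1, which is true only when
    component 1 exists, that is, when [0 < n]. *)
Definition big_mand (I : Type) (F : I -> multiformula atom) (s : seq I) :=
  foldr (fun c A => MAnd (F c) A) (MLabel 1 Top) s.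
Definition big_mor (I : Type) (F : I -> multiformula atom) (s : seq I) :=
  foldr (fun c A => MOr (F c) A) (MLabel 1 Bot) s.

Section BigMultiformulas.
Variables (I : Type) (F : I -> multiformula atom).

Lemma mvars_big_mand P s :
  (forall c, all P (mvars (F c))) -> all P (mvars (big_mand F s)).
Proof. by move=> PF; elim: s => //= c s; rewrite all_cat PF. Qed.

Lemma mvars_big_mor P s :
  (forall c, all P (mvars (F c))) -> all P (mvars (big_mor F s)).
Proof. by move=> PF; elim: s => //= c s; rewrite all_cat PF. Qed.

Lemma mlabels_big_mand (P : pred nat) s :
  P 1 -> (forall c, all P (mlabels (F c))) -> all P (mlabels (big_mand F s)).
Proof. by move=> P1 PF; elim: s => /= [|c s]; rewrite ?P1 // all_cat PF. Qed.

Lemma mlabels_big_mor (P : pred nat) s :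
  P 1 -> (forall c, all P (mlabels (F c))) -> all P (mlabels (big_mor F s)).
Proof. by move=> P1 PF; elim: s => /= [|c s]; rewrite ?P1 // all_cat PF. Qed.

Variables (n : nat) (M : model atom) (w : interpretation n M) (b : pred I).
Hypothesis bP : forall c, reflect (msat w (F c)) (b c).

Lemma msat_big_mand s : 0 < n -> reflect (msat w (big_mand F s)) (all b s).
Proof.
move=> n_gt0; elim: s => /= [|c s IHs].
  by constructor; exists (Ordinal n_gt0).
by apply: (iffP andP) => -[/bP ? /IHs ?].
Qed.

Lemma msat_big_mor s : reflect (msat w (big_mor F s)) (has b s).
Proof.
elim: s => /= [|c s IHs]; first by constructor; case.
by apply: (iffP orP) => -[/bP ?|/IHs ?]; by [left | right].
Qed.

End BigMultiformulas.

End Formulas.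

(** * Types over a finite set of atoms, configurations and their exclusion by a multiformula *)

Section Configurations.
Variables (atom : choiceType) (S : seq atom) (p : atom).

Local Notation atype := {set seq_sub S}.

(** The canonical cluster whose worlds are the types in [D]; atoms outside [S] are false
    everywhere. *)
Definition type_model (D : {set atype}) : model atom :=
  @Model atom {t : atype | t \in D} (fun _ _ => true)
    (fun q => [set t : {t : atype | t \in D} |
               q \in [seq ssval s | s in sval t]]).

Lemma type_model_val D (t : world (type_model D)) (s : seq_sub S) :
  (t \in Defs.val (type_model D) (ssval s)) = (s \in sval t).
Proof. by rewrite inE mem_image //; apply: val_inj. Qed.

Definition world_type (M : model atom) (x : world M) : atype :=
  [set s : seq_sub S | x \in Defs.val M (ssval s)].

Definition agree (M : model atom) (x : world M) (t : atype) :=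
  [forall s : seq_sub S,
     (ssval s != p) ==> ((x \in Defs.val M (ssval s)) == (s \in t))].

Lemma agree_world_type M (x : world M) : agree x (world_type x).
Proof. by apply/forallP => s; rewrite inE eqxx implybT. Qed.

(** The negation of the characteristic formula of [t] off [p], written directly as a disjunction of
    the opposite literals to stay in negation normal form. *)
Definition disagreement (t : atype) : form atom :=
  big_or [seq if s \in t then NVar (ssval s) else Var (ssval s)
         | s <- enum {: seq_sub S} & ssval s != p].

Lemma sat_disagreement M (x : world M) t :
  sat x (disagreement t) = ~~ agree x t.
Proof.
rewrite sat_big_or has_map negb_forall; apply/hasP/existsP => [[s]|[s]].
  rewrite mem_filter => /andP[sp _] /= sat_s; exists s; rewrite sp /=.
  by move: sat_s; case: (s \in t) => /=; case: (x \in _).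
rewrite negb_imply => /andP[sp neq_s]; exists s.
  by rewrite mem_filter sp mem_enum.
by move: neq_s => /=; case: (s \in t) => /=; case: (x \in _).
Qed.

Lemma vars_disagreement t : all [predD1 S & p] (vars (disagreement t)).
Proof.
rewrite vars_big_or all_map; apply/allP => s; rewrite mem_filter => /andP[sp _].
by rewrite /=; case: ifP => _ /=; rewrite sp ssvalP.
Qed.

Variable n : nat.

(** The dependent pair makes the marked types worlds of [type_model D] and keeps configurations a
    finite type, so that they can be enumerated. *)
Definition config := {D : {set atype} & {ffun 'I_n -> {t : atype | t \in D}}}.

Definition matches (M : model atom) (w : interpretation n M) (c : config) :=
  [&& [forall i, agree (w i) (sval (tagged c i))],
      [forall t in tag c, exists x : world M, agree x t]
    & [forall x : world M, exists t in tag c, agree x t]].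

(** The disjuncts negate the clauses of [matches] in order: some marked world disagrees with its
    type, some type of [D] is realised nowhere off [p], some world agrees with no type of [D]. The
    last two concern the whole cluster, so label 1 serves for both. *)
Definition mismatch (c : config) : multiformula atom :=
  MOr (big_mor (fun i : 'I_n => MLabel i.+1 (disagreement (sval (tagged c i))))
        (enum 'I_n))
    (MLabel 1
      (Or (big_or [seq Box (disagreement t) | t <- enum (tag c)])
          (Dia (big_and [seq disagreement t | t <- enum (tag c)])))).

Lemma mvars_mismatch c : all [predD1 S & p] (mvars (mismatch c)).
Proof.
rewrite /= !all_cat mvars_big_mor /=; last first.
  by move=> i; apply: vars_disagreement.
rewrite vars_big_or vars_big_and !all_map.
by apply/andP; split; apply/allP => t _ /=; apply: vars_disagreement.
Qed.

Lemma mlabels_mismatch c :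
  0 < n -> all (fun k => 1 <= k <= n) (mlabels (mismatch c)).
Proof.
move=> n_gt0; rewrite /= all_cat /= n_gt0 !andbT.
by apply: mlabels_big_mor => // i; rewrite /= ltn_ord.
Qed.

Lemma msat_mismatch M (w : interpretation n M) c :
  S5_model M -> 0 < n -> reflect (msat w (mismatch c)) (~~ matches w c).
Proof.
move=> S5 n_gt0; rewrite /matches !negb_and.
have labelP (i : 'I_n) : reflect
    (msat w (MLabel i.+1 (disagreement (sval (tagged c i)))))
    (~~ agree (w i) (sval (tagged c i))).
  rewrite -sat_disagreement.
  by apply: (iffP idP) => [|[j /= [/val_inj ->]]] //; exists i.
have -> : ~~ [forall i, agree (w i) (sval (tagged c i))] =
          has (fun i => ~~ agree (w i) (sval (tagged c i))) (enum 'I_n).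
  rewrite negb_forall; apply/existsP/hasP => [[i]|[i _]]; last by exists i.
  by exists i; rewrite ?mem_enum.
(* The modal part has the same truth value at every world [y] of a cluster. *)
have globalE (y : world M) : sat y
    (Or (big_or [seq Box (disagreement t) | t <- enum (tag c)])
        (Dia (big_and [seq disagreement t | t <- enum (tag c)]))) =
  ~~ [forall t in tag c, exists x : world M, agree x t]
  || ~~ [forall x : world M, exists t in tag c, agree x t].
  rewrite sat_Or sat_Dia // sat_big_or has_map; congr (_ || _).
    have BoxE : preim (fun t => Box (disagreement t)) (sat y) =1
                (fun t => [forall x : world M, ~~ agree x t]).
      move=> t; rewrite -[LHS]/(sat y (Box _)) sat_Box //.
      by apply: eq_forallb => x; rewrite sat_disagreement.
    rewrite (eq_has BoxE) negb_forall.
    apply/hasP/existsP => [[t tc dis]|[t]].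
      by exists t; rewrite -mem_enum tc negb_exists.
    by rewrite negb_imply negb_exists -mem_enum => /andP[tc dis]; exists t.
  rewrite negb_forall; apply: eq_existsb => x.
  rewrite sat_big_and all_map negb_exists; apply/allP/forallP => dis t.
    rewrite negb_and -implybE; apply/implyP => tc.
    by rewrite -sat_disagreement; apply: dis; rewrite mem_enum.
  rewrite mem_enum => tc; have := dis t.
  by rewrite tc -sat_disagreement.
apply: (iffP orP) => -[].
- by move/(msat_big_mor labelP); left.
- by move=> H; right; exists (Ordinal n_gt0); rewrite ?globalE.
- by move/(msat_big_mor labelP); left.
- by case=> j _; rewrite globalE; right.
Qed.

Definition model_types (M : model atom) : {set atype} :=
  [set world_type x | x : world M].

Definition to_types (M : model atom) (x : world M) :
    world (type_model (model_types M)) :=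
  exist _ (world_type x) (imset_f _ isT).

Lemma to_types_surj M y : exists x : world M, to_types x = y.
Proof.
case: y => t t_in; have /imsetP[x _ xt] := t_in.
by exists x; apply: val_inj.
Qed.

Lemma to_types_val M (x : world M) q : q \in S ->
  (x \in Defs.val M q) =
  (to_types x \in Defs.val (type_model (model_types M)) q).
Proof. by move=> qS; rewrite (type_model_val _ (SeqSub qS)) inE. Qed.

(** The configuration that [M] itself realises, with [p] included in the types if it lies in [S]. *)
Definition model_config (M : model atom) (w : interpretation n M) : config :=
  Tagged (fun D : {set atype} => {ffun 'I_n -> {t : atype | t \in D}})
    [ffun i => to_types (w i)].

Lemma matches_model_config M (w : interpretation n M) :
  matches w (model_config w).
Proof.
apply/and3P; split; apply/forallP.
- by move=> i /=; rewrite ffunE agree_world_type.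
- move=> t; apply/implyP => /imsetP[x _ ->].
  by apply/existsP; exists x; apply: agree_world_type.
- move=> x; apply/existsP; exists (world_type x).
  by rewrite imset_f // agree_world_type.
Qed.

(** * Amalgamating a model with a set of types *)

Section Amalgam.
Variables (M : model atom) (D : {set atype}).

Definition amalgam : model atom :=
  @Model atom
    {z : world M * world (type_model D) | agree z.1 (sval z.2)}
    (fun _ _ => true)
    (fun q => [set z | if q == p then (sval z).2 \in Defs.val (type_model D) q
                       else (sval z).1 \in Defs.val M q]).

(** For [q] other than [p] the two coordinates agree by the choice of worlds, so the second
    projection preserves every atom of [S]. *)
Lemma amalgam_val (z : world amalgam) q : q \in S ->
  (z \in Defs.val amalgam q) = ((sval z).2 \in Defs.val (type_model D) q).
Proof.
move=> qS; rewrite inE; case: eqP => // /eqP qp.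
have /forallP/(_ (SeqSub qS)) := valP z.
by rewrite qp (type_model_val _ (SeqSub qS)) => /eqP.
Qed.

(** The graph of the first projection works: atoms other than [p], also those outside [S], are read
    from the world of [M], and forth needs only that each world has a partner type in [D]. *)
Lemma amalgam_bisimulation :
  S5_model M -> [forall x : world M, exists t in D, agree x t] ->
  @bisimulation_upto _ p M amalgam (fun x z => x = (sval z).1).
Proof.
move=> S5 /forallP matchM; split.
- by move=> x z q -> /eqP/negPf qp; rewrite inE qp.
- move=> x z y _ _; have /existsP[t /andP[tD yt]] := matchM y.
  by exists (exist _ (y, exist _ t tD) yt).
- by move=> x z z' _ _; exists (sval z').1.
Qed.

Lemma amalgam_surj :
  [forall t in D, exists x : world M, agree x t] ->
  forall t : world (type_model D), exists z : world amalgam, (sval z).2 = t.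
Proof.
move=> /forall_inP matchD t; have /existsP[x xt] := matchD _ (valP t).
by exists (exist _ (x, t) xt).
Qed.

End Amalgam.

End Configurations.

(** * The interpolant as a conjunction over refuting configurations *)

Section Interpolant.
Variables (atom : choiceType) (n : nat) (G : hypersequent atom n).

Definition hatoms : seq atom :=
  flatten [seq flatten [seq vars f | f <- enum_mset (tnth G i)]
          | i <- enum 'I_n].

Lemma hatomsP q : reflect (exists i f, f \in tnth G i /\ q \in vars f)
                          (q \in hatoms).
Proof.
apply: (iffP flatten_mapP) => [[i _ /flatten_mapP[f fG qf]]|[i [f [fG qf]]]].
  by exists i, f.
by exists i; rewrite ?mem_enum //; apply/flatten_mapP; exists f.
Qed.

Definition hsatb (M : model atom) (w : interpretation n M) : bool :=
  [exists i, has (sat (w i)) (enum_mset (tnth G i))].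

Lemma hsatP M (w : interpretation n M) : reflect (hsat w G) (hsatb w).
Proof.
apply: (iffP existsP) => [[i /hasP[f fG sf]]|[i [f [fG sf]]]].
  by exists i, f.
by exists i; apply/hasP; exists f.
Qed.

Lemma hsatb_surjection (M N : model atom) (h : world M -> world N)
    (w : interpretation n M) (v : interpretation n N) :
  S5_model M -> S5_model N -> (forall y, exists x, h x = y) ->
  (forall x q, q \in hatoms -> (x \in Defs.val M q) = (h x \in Defs.val N q)) ->
  (forall i, h (w i) = v i) -> hsatb w = hsatb v.
Proof.
move=> S5M S5N h_surj h_val hw; apply: eq_existsb => i.
apply: eq_in_has => f fG; rewrite -hw.
apply: (sat_surjection S5M S5N h_surj h_val) => q qf.
by apply/hatomsP; exists i, f.
Qed.

(** Evaluated in the canonical cluster, where [p] still counts as an atom of the types if it occurs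
    in [G]. *)
Definition refuting (c : config hatoms n) : bool :=
  ~~ @hsatb (type_model (tag c)) (tagged c).

Definition interpolant (p : atom) : multiformula atom :=
  big_mand (@mismatch atom hatoms p n) (enum refuting).

End Interpolant.

Theorem theorem6 (atom : choiceType) (n : nat) (n_gt0 : 0 < n)
    (G : hypersequent atom n)
    (G_depth : forall (k : nat) (f : form atom),
       in_hypersequent G k f -> depth f <= 1)
    (p : atom) :
  exists A : multiformula atom,
    [/\ (forall q : atom, q \in mvars A -> hvar G q /\ q <> p)
          /\ (forall k : nat, k \in mlabels A -> 1 <= k <= n),
        forall (M : model atom) (w : interpretation n M),
          S5_model M -> msat w A -> hsat w G
      & forall (M : model atom) (w : interpretation n M),
          S5_model M -> ~ msat w A ->
          exists (M' : model atom) (w' : interpretation n M'),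
            [/\ S5_model M', bisimilar_upto p w w' & ~ hsat w' G]].
Proof.
exists (interpolant G p); split=> [|M w S5 satA|M w S5 nsatA].
- split=> [q|].
    have /allP sub := mvars_big_mand (enum (@refuting _ _ G))
      (fun c => mvars_mismatch p c).
    move=> /sub /andP[/eqP qp /hatomsP[i [f [fG qf]]]]; split=> //.
    by exists i.+1, f; split=> //; exists i.
  apply/allP; apply: mlabels_big_mand => [|c]; first exact: n_gt0.
  exact: mlabels_mismatch.
(* If [w] refuted [G], so would the configuration of [M]; the interpolant would exclude it, yet [M]
   matches it. *)
- apply/hsatP; apply: contraT => nsat.
  have /allP/(_ (model_config (hatoms G) w)) :=
    introT (msat_big_mand (fun c => msat_mismatch p w c S5 n_gt0) _ n_gt0) satA.
  rewrite matches_model_config mem_enum; apply.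
  rewrite unfold_in /refuting; apply: contra nsat => sat_c.
  rewrite (hsatb_surjection (h := @to_types _ _ M)
             (v := tagged (model_config (hatoms G) w))) //.
  + exact: to_types_surj.
  + exact: to_types_val.
  + by move=> i; rewrite ffunE.
- have : ~~ all (fun c => ~~ matches p w c) (enum (@refuting _ _ G)).
    apply/negP => /(msat_big_mand
      (fun c => msat_mismatch p w c S5 n_gt0) _ n_gt0).
    exact: nsatA.
  move=> /allPn[c]; rewrite mem_enum negbK => ref_c /and3P[/forallP wc Dc Mc].
  (* Each marked world is paired with the type that the matched refuting configuration [c] assigns
     to it. *)
  pose w' i : world (amalgam p M (tag c)) := exist _ (w i, tagged c i) (wc i).
  exists (amalgam p M (tag c)), w'; split=> //.
    exists (fun x z => x = (sval z).1); split=> //.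
    exact: amalgam_bisimulation.
  move=> /hsatP; apply/negP; move: ref_c; rewrite unfold_in /refuting.
  congr (~~ _); symmetry.
  (* The second projection maps the amalgam onto the canonical cluster of [c], so the refutation of
     [G] there transfers back. *)
  pose h (z : world (amalgam p M (tag c))) := (sval z).2.
  apply: (hsatb_surjection (h := h)) => //.
  + exact: amalgam_surj.
  + exact: amalgam_val.
Qed.
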